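(* Let $X$ be a real Banach space, let $f: X \to \mathbb{R}\cup\{+\infty\}$ be a proper lower semicontinuous convex function, and let $S\subset X$ be a nonempty bounded set with $\overline{S}\subset\operatorname{dom}f$. If $\ell\geq 0$ is such that $\partial f(x)\cap\ell\mathbb{B}^*\neq\emptyset$ for all $x\in\operatorname{bd}(S)$, then $$\sup_{x\in S}f(x)\leq\inf_{x\in S}f(x)+\ell \operatorname{diam}(S),$$ where $\operatorname{diam}(S):=\sup\{\|s_1-s_2\|:s_1,s_2\in S\}$ is the diameter of $S$.
   Context: $X^*$ is the continuous dual of $X$ with its dual norm, $\mathbb{B}^*$ is the closed unit ball of $X^*$ (so $\ell\mathbb{B}^*=\{x^*\in X^*:\|x^*\|\le \ell\}$). $\overline{S}$ and $\operatorname{bd}(S)$ are the closure and boundary of $S$ in the norm topology of $X$. For $f:X\to\mathbb{R}\cup\{+\infty\}$, $\operatorname{dom}f=\{x\in X: f(x)\in\mathbb{R}\}$; $f$ is proper if $\operatorname{dom} f\neq\emptyset$, convex (resp. lower semicontinuous) if its epigraph $\{(x,r)\in X\times\mathbb{R}: f(x)\le r\}$ is convex (resp. closed in $X\times\mathbb{R}$). The subdifferential of $f$ at $x$ with $f(x)$ finite is $\partial f(x)=\{x^*\in X^*: f(y)-f(x)\ge\langle x^*,y-x\rangle\ \forall y\in X\}$. *)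

(* Defs.v *)
From HB Require Import structures.
From mathcomp Require Export all_boot all_order all_algebra.
From mathcomp Require Export all_classical all_reals all_analysis.

Set Implicit Arguments.
Unset Strict Implicit.
Unset Printing Implicit Defensive.

Import Order.TTheory GRing.Theory Num.Theory.
Import numFieldNormedType.Exports.

Local Open Scope classical_set_scope.
Local Open Scope ring_scope.
Local Open Scope ereal_scope.

(* Functions with values in R U {+oo} are functions f : X -> \bar R together
   with a separate hypothesis that f never takes the value -oo. *)
Section extended_real_functions.
Context {R : realType} {X : normedModType R}.
Implicit Types f : X -> \bar R.

Definition domain f : set X := [set x | f x \is a fin_num].

Definition proper f : Prop := domain f !=set0.

(* R^o is R seen as a normed module over itself, so that X * R^o carries both
   the product topology and the product vector space structure. *)
Definition epigraph f : set (X * R^o) := [set p | f p.1 <= p.2%:E].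

Definition econvex f : Prop := convex_set (M := (X * R^o)%type) (epigraph f).

Definition elsc f : Prop := closed (epigraph f).

End extended_real_functions.

Section duality.
Context {R : realType} {X : normedModType R}.
Implicit Types (phi : {linear X -> R^o}) (f : X -> \bar R) (x : X) (l : R).

Definition dual : set {linear X -> R^o} := [set phi | continuous phi].

Definition dual_norm phi : \bar R :=
  ereal_sup [set `|phi x|%:E | x in [set x : X | (`|x| <= 1)%R]].

Definition dual_ball l : set {linear X -> R^o} :=
  [set phi | dual phi /\ dual_norm phi <= l%:E].

(* Only meaningful when f x is finite. *)
Definition subdifferential f x : set {linear X -> R^o} :=
  [set phi | dual phi /\ forall y, (phi (y - x)%R)%:E <= f y - f x].

End duality.

Section sets.
Context {R : realType} {X : normedModType R}.

Definition boundary (S : set X) : set X := closure S `\` interior S.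

Definition diam (S : set X) : \bar R :=
  ereal_sup [set `|(s.1 - s.2)%R|%:E | s in S `*` S].

End sets.

(* Main.v *)
Require Import Defs.
Import numFieldNormedType.Exports.

(** Let [x] and [y] be distinct points of [S].  The half-line that starts at
    [x] and runs away from [y] leaves the bounded set [S], so it meets the
    boundary of [S] at some [z = x + t (x - y)] with [t >= 0]
    ([ray_meets_boundary]).  A subgradient at [z] of norm at most [l] gives
    [f z <= f y + l |z - y|] ([le_subgradient]), and convexity along the
    segment from [y] to [z], on which [x] sits at the fraction [1 / (1 + t)]
    of the way, scales this down to [f x <= f y + l |x - y|]
    ([le_of_boundary_subgradient]): the slope of a convex function from [y] to
    [x] does not exceed its slope from [y] to the farther point [z].  Bounding
    [|x - y|] by the diameter and then taking the supremum over [x] and the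
    infimum over [y] yields the theorem. *)

Set Implicit Arguments.
Unset Strict Implicit.
Unset Printing Implicit Defensive.

Import Order.TTheory GRing.Theory Num.Theory.

Local Open Scope classical_set_scope.
Local Open Scope ring_scope.
Local Open Scope ereal_scope.

Section subgradient_estimates.
Context {R : realType} {X : normedModType R}.
Implicit Types (phi : {linear X -> R^o}) (f : X -> \bar R) (S : set X).
Implicit Types (x y v : X) (l : R).

Lemma le_dual_norm phi l v : dual_norm phi <= l%:E ->
  (`|phi v| <= l * `|v|)%R.
Proof.
move=> phil; have [->|v0] := eqVneq v 0%R.
  by rewrite linear0 !normr0 mulr0.
have nv0 : (0 < `|v|)%R by rewrite normr_gt0.
have : `|phi (`|v|^-1 *: v)|%:E <= l%:E.
  apply: le_trans phil; apply: ereal_sup_ubound.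
  exists (`|v|^-1 *: v)%R => //=.
  by rewrite normrZ normfV normr_id mulVf// gt_eqF.
rewrite lee_fin linearZ/= normrZ normfV normr_id.
by rewrite mulrC ler_pdivrMr.
Qed.

Lemma le_subgradient f l x y : f x \is a fin_num ->
  subdifferential f x `&` dual_ball l !=set0 ->
  f x <= f y + (l * `|x - y|)%:E.
Proof.
move=> fx [phi [[_ /(_ y) sub] [_ phil]]].
have bnd := le_dual_norm (y - x)%R phil.
have : (- (l * `|x - y|))%:E <= f y - f x.
  apply: le_trans sub; rewrite lee_fin distrC lerNl.
  by apply: le_trans bnd; rewrite -normrN ler_norm.
by rewrite leeBrDr// addeC EFinN leeBlDr.
Qed.

Lemma econvex_le f x y (a b t : R) : econvex f ->
  (0 <= t <= 1)%R -> f x <= a%:E -> f y <= b%:E ->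
  f (t *: x + (1 - t) *: y)%R <= (t * a + (1 - t) * b)%:E.
Proof.
move=> cvx t01 fxa fyb.
have t01' : Itv.spec (@Itv.num_sem R) (Itv.Real `[0, 1]%Z) t.
  by rewrite /= /Itv.num_sem/= in_itv/= num_real.
have := cvx (x, a) (y, b) (Itv.mk t01').
by rewrite !inE; apply.
Qed.

(** The witness is the supremum of the times at which the ray is in [S].  The
    point reached then is a limit of points of [S], and if it were interior
    the ray would still be in [S] slightly later. *)
Lemma ray_meets_boundary S x v : bounded_set S -> S x -> v != 0%R ->
  exists2 t : R, (0 <= t)%R & boundary S (x + t *: v)%R.
Proof.
move=> [M [_ bndM]] Sx v0.
have nv0 : (0 < `|v|)%R by rewrite normr_gt0.
pose ray := (fun t : R^o => x + t *: v)%R.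
have ray_cont : continuous ray.
  move=> t; apply: cvgD; first exact: cvg_cst.
  by apply: cvgZr_tmp; exact: cvg_id.
pose T : set R := ray @^-1` S.
have T0 : T 0%R by rewrite /T/= /ray scale0r addr0.
have Tub : has_ubound T.
  exists ((M + 1 + `|x|) / `|v|)%R => t Tt.
  rewrite ler_pdivlMr//; apply: le_trans (_ : (`|t *: v| <= _)%R).
    by rewrite normrZ ler_wpM2r// ler_norm.
  have -> : (t *: v = ray t - x)%R by rewrite /ray addrC addKr.
  rewrite (le_trans (ler_normB _ _))// lerD2r.
  by apply: (bndM (M + 1)%R) => //; rewrite ltrDl.
exists (sup T); first exact: ub_le_sup.
split.
  have clT : closure T (sup T) by apply: closure_sup => //; exists 0%R.
  move=> B /ray_cont rayB.
  by have [t [Tt Bt]] := clT _ rayB; exists (ray t).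
move=> intS.
have /nbhs_ballP[e /= e0 eT] : nbhs (sup T : R^o) T by exact: ray_cont intS.
have /(ub_le_sup Tub) : T (sup T + e / 2)%R.
  apply: eT; rewrite /ball/= opprD addNKr normrN gtr0_norm ?divr_gt0//.
  by rewrite ltr_pdivrMr// ltr_pMr// ltr1n.
by rewrite gerDl leNgt divr_gt0.
Qed.

(** The dilation [z - y = (1 + t) (x - y)] enlarges the Lipschitz bound at [z]
    by the factor [1 + t], which the weight [1 / (1 + t)] of [z] in the convex
    combination giving [x] cancels exactly. *)
Lemma le_of_boundary_subgradient f S l x y : econvex f -> bounded_set S ->
  boundary S `<=` domain f ->
  (forall z, boundary S z -> subdifferential f z `&` dual_ball l !=set0) ->
  S x -> f y \is a fin_num ->
  f x <= f y + (l * `|x - y|)%:E.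
Proof.
move=> cvx Sb Sdom fsub Sx fy.
have [->|xy] := eqVneq x y; first by rewrite subrr normr0 mulr0 adde0.
have [t t0 bz] : exists2 t : R, (0 <= t)%R & boundary S (x + t *: (x - y))%R.
  by apply: ray_meets_boundary; rewrite ?subr_eq0.
set z := (x + t *: (x - y))%R in bz.
have t1 : (0 < 1 + t)%R by rewrite ltr_wpDr.
have zy : (z - y = (1 + t) *: (x - y))%R.
  by rewrite /z scalerDl scale1r addrAC.
have fz := le_subgradient y (Sdom _ bz) (fsub _ bz).
rewrite zy normrZ (gtr0_norm t1) -(fineK fy) -EFinD in fz.
have fy' : f y <= (fine (f y))%:E by rewrite fineK.
have s01 : (0 <= (1 + t)^-1 <= 1)%R.
  by rewrite invr_ge0 (ltW t1)/= invf_le1// lerDl.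
have := econvex_le cvx s01 fz fy'.
have -> : ((1 + t)^-1 *: z + (1 - (1 + t)^-1) *: y = x)%R.
  rewrite scalerBl scale1r addrCA -scalerBr zy scalerA mulVf ?gt_eqF//.
  by rewrite scale1r addrC subrK.
move=> /le_trans; apply; rewrite -[in leRHS](fineK fy) -EFinD lee_fin.
rewrite mulrDr mulrBl mul1r addrC addrA subrK lerD2l.
by rewrite mulrCA mulKf ?gt_eqF.
Qed.

Lemma diam_ge S x y : S x -> S y -> `|(x - y)%R|%:E <= diam S.
Proof. by move=> Sx Sy; apply: ereal_sup_ubound; exists (x, y). Qed.

Lemma diam_fin_num S : S !=set0 -> bounded_set S -> diam S \is a fin_num.
Proof.
move=> [x Sx] [M [_ bndM]]; rewrite fin_numElt; apply/andP; split.
  by apply: lt_le_trans (diam_ge Sx Sx); rewrite ltNyr.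
have bnd1 : forall s, S s -> (`|s| <= M + 1)%R.
  by apply: bndM; rewrite ltrDl.
apply: le_lt_trans (ltry (M + 1 + (M + 1))%R).
apply: ge_ereal_sup => _ [[a b] [/= Sa Sb] <-]; rewrite lee_fin.
by rewrite (le_trans (ler_normB _ _))// lerD// bnd1.
Qed.

End subgradient_estimates.

Theorem corollary4p1 (R : realType) (X : completeNormedModType R)
    (f : X -> \bar R) (S : set X) (l : R)
    (f_gtNy : forall x, -oo < f x)
    (f_proper : proper f) (f_lsc : elsc f) (f_convex : econvex f)
    (S_neq0 : S !=set0) (S_bounded : bounded_set S)
    (S_dom : closure S `<=` domain f)
    (l_ge0 : (0 <= l)%R)
    (f_subdiff : forall x, boundary S x ->
       subdifferential f x `&` dual_ball l !=set0) :
  ereal_sup (f @` S) <= ereal_inf (f @` S) + l%:E * diam S.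
Proof.
have diamS := diam_fin_num S_neq0 S_bounded.
apply: ge_ereal_sup => _ [x Sx <-].
rewrite -leeBlDr ?fin_numM//.
apply: le_ereal_inf_tmp => _ [y Sy <-].
rewrite leeBlDr ?fin_numM//.
apply: (@le_trans _ _ (f y + (l * `|x - y|)%:E)).
  apply: (le_of_boundary_subgradient (S := S)) => //.
    by move=> z [clz _]; exact: S_dom.
  exact/S_dom/subset_closure.
by rewrite leeD2l// EFinM lee_wpmul2l ?lee_fin// diam_ge.
Qed.
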